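(* Let $\lambda_1(A_n)$ be the smallest eigenvalue of the $n\times n$ Toeplitz matrix $A_n = T_n(f_n)$, where $f_n(\theta)=\sum_{j=0}^{n-1} \left(\tfrac1n\right)^{j/n}|\theta|^{2-j/n}$ for $\theta\in[-\pi,\pi]$. Then $$n\,\lambda_1(A_n)\le k_1+O\Big(\frac1n\Big)\quad\text{as } n\to\infty,$$ where the constant $k_1$ is given by $$k_1=\left\{\int_0^\infty \frac{u^2-u}{(u^2-\pi^2)^2}\cdot\frac{\cos^2(\frac u2)}{\log(u)}\,du\right\}\left\{\int_0^{\pi}\frac{\cos^2(\frac u2)}{(u^2-\pi^2)^2}\,du\right\}^{-1},$$ and can be numerically approximated as $12.9301$.
   Context: For an integrable function $b:[-\pi,\pi]\to\mathbb R$, $T_n(b)$ denotes the $n\times n$ Toeplitz matrix with entries $(T_n(b))_{j,k}=\hat b_{j-k}$, $j,k=1,\dots,n$, where $\hat b_m=\frac{1}{2\pi}\int_{-\pi}^{\pi} b(\theta)e^{-\mathrm i m\theta}\,d\theta$. With $h=\frac1n$, the symbol is $f_n(\theta)=\sum_{j=0}^{n-1}h^{jh}|\theta|^{2-jh}$ (with $f_n(0)=0$). It is real-valued and even, so $A_n$ is real symmetric. Its eigenvalues are arranged in nondecreasing order $\lambda_1(A_n)\le\cdots\le\lambda_n(A_n)$. The integrands in the definition of $k_1$ are extended by continuity at $u=0$, $u=1$ and $u=\pi$ where needed; $\log$ is the natural logarithm.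
   Formalization: The closing claim that k_1 is approximately 12.9301 is dropped, because it is false for the displayed formula (which gives k_1 < 10.8, numerically about 7.32); the bound with the displayed k_1 is kept unchanged. *)

(* Defs.v *)
From HB Require Import structures.
From mathcomp Require Import all_boot all_order all_algebra.
From mathcomp Require Import complex.
From mathcomp Require Import all_classical all_reals all_analysis.
Set Implicit Arguments.
Unset Strict Implicit.
Unset Printing Implicit Defensive.
Import Order.TTheory GRing.Theory Num.Theory.
Import numFieldNormedType.Exports.
Local Open Scope classical_set_scope.
Local Open Scope complex_scope.
Local Open Scope ring_scope.

(* MathComp-Analysis has no integral of complex-valued functions: integrate
   the real and the imaginary part. *)
Definition complex_integral (R : realType) (D : set R) (F : R -> R[i]) : R[i] :=
  (\int[lebesgue_measure]_(x in D) complex.Re (F x)) +i*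
  (\int[lebesgue_measure]_(x in D) complex.Im (F x)).

(* e^(i t) *)
Definition expi (R : realType) (t : R) : R[i] := cos t +i* sin t.

Definition fourier_coef (R : realType) (b : R -> R) (m : int) : R[i] :=
  ((2 * pi)^-1)%:C *
  complex_integral `[- pi, pi] (fun t => (b t)%:C * expi (- (m%:~R * t))).

Definition toeplitz (R : realType) (n : nat) (b : R -> R) : 'M[R[i]]_n :=
  \matrix_(j, k) fourier_coef b (j%:Z - k%:Z).

(* For n > 0 all exponents are positive and 0 `^ a = 0 for a != 0, so that
   symbol n 0 = 0. *)
Definition symbol (R : realType) (n : nat) (theta : R) : R :=
  \sum_(j < n) (n%:R^-1) `^ (j%:R / n%:R) * `|theta| `^ (2 - j%:R / n%:R).

(* On R[i], x <= y means that y - x is a nonnegative real: the second clause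
   also says that every eigenvalue of A is real. *)
Definition smallest_eigenvalue (R : realType) (n : nat) (A : 'M[R[i]]_n)
    (l : R) : Prop :=
  eigenvalue A l%:C /\ forall z : R[i], eigenvalue A z -> l%:C <= z.

(* The continuous extensions of the integrands at 0, 1 and pi only affect a
   Lebesgue-null set, hence not the integrals. *)
Definition k1 (R : realType) : R :=
  (\int[lebesgue_measure]_(u in `[0, +oo[)
     ((u ^+ 2 - u) / (u ^+ 2 - pi ^+ 2) ^+ 2 * (cos (u / 2) ^+ 2 / ln u))) *
  (\int[lebesgue_measure]_(u in `[0, pi])
     (cos (u / 2) ^+ 2 / (u ^+ 2 - pi ^+ 2) ^+ 2))^-1.

(* Main.v *)
(* The Rayleigh quotient of the Toeplitz matrix at the Dirichlet eigenvector
   x_j = cos ((j - (n-1)/2) pi/(n+1)) of the discrete Laplacian is, up to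
   normalisation, the integral of the symbol against |p|^2, where
   p(t) (cos t - cos (pi/(n+1))) = sin (pi/(n+1)) cos ((n+1)t/2).  After the
   substitution t = u/(n+1), the integrand is at most a factor E_n(u) times
   8 pi W(u), where W is the integrand of the numerator of k1; E_n tends to 1
   uniformly on bounded sets and is bounded on [0, pi (n+1)].  Hence
   limsup n lambda_1 <= 8 pi * int_0^oo W.  No rate is needed beyond this:
   |sin x| <= |x| gives
   cos^2(u/2) / (u^2 - pi^2)^2 <= 1 / (4 (u + pi)^2), whose integral over
   [0, pi] is 1/(8 pi), and the inequality is strict, so 8 pi * int W < k1. *)
Require Import Defs.
From HB Require Import structures.
From mathcomp Require Import all_boot all_order all_algebra.
From mathcomp Require Import complex.
From mathcomp Require Import all_classical all_reals all_analysis.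
From mathcomp Require Import spectral sesquilinear ring lra measurable_realfun.
Set Implicit Arguments.
Unset Strict Implicit.
Unset Printing Implicit Defensive.
Import Order.TTheory GRing.Theory Num.Theory.
Import numFieldNormedType.Exports.
Local Open Scope classical_set_scope.
Local Open Scope ring_scope.

(** * Rayleigh quotients *)

Section hermitian.
Local Open Scope sesquilinear_scope.
Variable R : realType.
Local Notation C := R[i].

Lemma spectralmx_mul n (A : 'M[C]_n) : A \is normalmx ->
  spectralmx A *m A = diag_mx (spectral_diag A) *m spectralmx A.
Proof.
move=> /orthomx_spectralP AE.
by rewrite {2}AE !mulmxA mulmxV ?spectral_unit // mul1mx.
Qed.

(** Eigenvectors are row vectors here, so row [i] of [spectralmx A] is the witness; it is nonzero
    because that matrix is invertible. *)
Lemma spectral_diag_eigenvalue n (A : 'M[C]_n) i : A \is normalmx ->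
  eigenvalue A (spectral_diag A 0 i).
Proof.
move=> /spectralmx_mul PA; apply/eigenvalueP; exists (row i (spectralmx A)).
  by rewrite -row_mul PA row_mul row_diag_mx -scalemxAl -rowE.
rewrite rowE; apply/eqP => /(congr1 (mulmx^~ (invmx (spectralmx A)))).
rewrite mulmxK ?spectral_unit // mul0mx => /matrixP/(_ 0 i)/eqP.
by rewrite !mxE !eqxx oner_eq0.
Qed.

Lemma eigenvalue_spectral_diag n (A : 'M[C]_n) z : A \is normalmx ->
  eigenvalue A z -> exists i, z = spectral_diag A 0 i.
Proof.
move=> /orthomx_spectralP; set P := spectralmx A.
set d := spectral_diag A => AE.
have PU : P \in unitmx by exact: spectral_unit.
move=> /eigenvalueP[v vA v0].
have wD : (v *m invmx P) *m diag_mx d = z *: (v *m invmx P).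
  by rewrite scalemxAl -vA [in RHS]AE !mulmxA mulmxK.
have /rV0Pn[i wi] : v *m invmx P != 0.
  by apply: contra v0 => /eqP w0; rewrite -(mulmxKV PU v) w0 mul0mx.
exists i; have /rowP/(_ i) := wD; rewrite mul_mx_diag mxE [RHS]mxE mulrC.
by move=> /(mulIf wi).
Qed.

(** The eigenvalues are exactly the entries of [spectral_diag A], which are real for a Hermitian
    matrix, so the entry with least real part is below all of them. Positivity of [n] makes this
    finite family nonempty. *)
Lemma hermitian_smallest_eigenvalue n (A : 'M[C]_n) : (0 < n)%N ->
  A \is hermsymmx -> exists l : R, smallest_eigenvalue A l.
Proof.
case: n A => // n A _ hA; have nA := hermitian_normalmx hA.
have dR i : spectral_diag A 0 i = (complex.Re (spectral_diag A 0 i))%:C%C.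
  have /mxOverP/(_ 0 i)/CrealP := hermitian_spectral_diag_real hA.
  case: (spectral_diag A 0 i) => a b [] /eqP.
  by rewrite eq_sym -addr_eq0 -mulr2n mulrn_eq0 /= => /eqP ->.
pose k := [arg min_(i < (ord0 : 'I_n.+1)) complex.Re (spectral_diag A 0 i)]%O.
exists (complex.Re (spectral_diag A 0 k)); split.
  by rewrite -dR spectral_diag_eigenvalue.
move=> z /(eigenvalue_spectral_diag nA)[i ->]; rewrite [leRHS]dR lecR.
by rewrite /k; case: arg_minP => // j _; exact.
Qed.

(** In the coordinates [w] of [v] along the orthonormal eigenbasis, both sides are sums over [i] of
    the squared modulus of [w_i], weighted by [l] on the left and by the [i]-th eigenvalue on the
    right. They are compared term by term. *)
Lemma hermitian_rayleigh n (A : 'M[C]_n) (l : R) : A \is hermsymmx ->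
  smallest_eigenvalue A l -> forall v : 'rV[C]_n,
  l%:C%C * (v *m v^t*) 0 0 <= (v *m A *m v^t*) 0 0.
Proof.
move=> /hermitian_normalmx nA [_ lmin] v.
set P := spectralmx A; set d := spectral_diag A.
have PU : P \is unitarymx by exact: spectral_unitarymx.
pose w := v *m invmx P.
have vE : v = w *m P by rewrite mulmxKV // unitarymx_unit.
clearbody w; have -> : v *m v^t* = w *m w^t*.
  by rewrite vE trmx_mul map_mxM mulmxA mulmxtVK.
have -> : v *m A *m v^t* = w *m diag_mx d *m w^t*.
  rewrite vE -[_ *m _ *m A]mulmxA spectralmx_mul // trmx_mul map_mxM !mulmxA.
  by rewrite mulmxtVK.
rewrite !mxE mulr_sumr; apply: ler_sum => i _.
rewrite mul_mx_diag !mxE [leLHS]mulrC [leRHS]mulrAC ler_wpM2l ?mul_conjC_ge0 //.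
exact/lmin/spectral_diag_eigenvalue.
Qed.
End hermitian.

(** * The quadratic form of a Toeplitz matrix as an integral against its symbol *)

Lemma Rintegral_sum d (T : measurableType d) (R : realType)
    (nu : measure T R) (D : set T) (I : Type) (r : seq I) (f : I -> T -> R) :
  measurable D -> (forall i, nu.-integrable D (EFin \o f i)) ->
  \int[nu]_(x in D) (\sum_(i <- r) f i x) = \sum_(i <- r) \int[nu]_(x in D) f i x.
Proof.
move=> mD intf; rewrite /Rintegral.
under eq_integral do rewrite -sumEFin.
rewrite integral_sum // -sum_fine // => i _.
exact: (integrable_fin_num mD (intf i)).
Qed.

Section toeplitz_form.
Local Open Scope sesquilinear_scope.
Variable R : realType.
Local Notation C := R[i].
Local Notation mu := (@lebesgue_measure R).

Lemma continuous_integrable_itv (f : R -> R) (a b : R) : continuous f ->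
  mu.-integrable `[a, b] (EFin \o f).
Proof.
move=> cf; apply: continuous_compact_integrable; first exact: segment_compact.
exact: continuous_subspaceT.
Qed.

Lemma continuous_sumr (I : Type) (r : seq I) (f : I -> R -> R) :
  (forall i, continuous (f i)) -> continuous (fun x => \sum_(i <- r) f i x).
Proof.
move=> cf; elim: r => [|i r IHr] x.
  by under eq_fun do rewrite big_nil; exact: cvg_cst.
by under eq_fun do rewrite big_cons; apply: cvgD; [exact: cf|exact: IHr].
Qed.

Lemma continuous_cosM (w : R) : continuous (fun t : R => cos (w * t)).
Proof.
move=> t; apply: (continuous_comp _ (@continuous_cos R _)).
by apply: cvgM; [exact: cvg_cst|exact: cvg_id].
Qed.

Lemma continuous_sinM (w : R) : continuous (fun t : R => sin (w * t)).
Proof.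
move=> t; apply: (continuous_comp _ (@continuous_sin R _)).
by apply: cvgM; [exact: cvg_cst|exact: cvg_id].
Qed.


Lemma fourier_coefE (b : R -> R) (m : int) : continuous b ->
  fourier_coef b m =
    ((2 * pi)^-1 * \int[mu]_(t in `[- pi, pi]) (b t * cos (m%:~R * t)) +i*
    - ((2 * pi)^-1 * \int[mu]_(t in `[- pi, pi]) (b t * sin (m%:~R * t))))%C.
Proof.
move=> cb; rewrite /fourier_coef /complex_integral /expi.
have -> : \int[mu]_(t in `[- pi, pi])
    complex.Re ((b t)%:C%C * (cos (- (m%:~R * t)) +i* sin (- (m%:~R * t)))%C) =
    \int[mu]_(t in `[- pi, pi]) (b t * cos (m%:~R * t)).
  by apply: eq_Rintegral => t _ /=; rewrite cosN mul0r subr0.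
have -> : \int[mu]_(t in `[- pi, pi])
    complex.Im ((b t)%:C%C * (cos (- (m%:~R * t)) +i* sin (- (m%:~R * t)))%C) =
    - \int[mu]_(t in `[- pi, pi]) (b t * sin (m%:~R * t)).
  rewrite -[RHS]mulN1r -RintegralZl //; last first.
    apply: continuous_integrable_itv => t; apply: cvgM; first exact: cb.
    exact: continuous_sinM.
  by apply: eq_Rintegral => t _ /=; rewrite sinN mul0r addr0 mulrN mulN1r.
by apply/eqP; rewrite eq_complex /= !mul0r subr0 addr0 mulrN !eqxx.
Qed.

(** Since [b] is real, changing [m] into [-m] conjugates the Fourier coefficient: cosine is even and
    sine is odd. *)
Lemma toeplitz_hermitian n (b : R -> R) : continuous b ->
  toeplitz n b \is hermsymmx.
Proof.
move=> cb; apply/is_hermitianmxP; rewrite expr0 scale1r.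
apply/matrixP => j k; rewrite !mxE !fourier_coefE //.
have -> : (k%:Z - j%:Z)%:~R = - (j%:Z - k%:Z)%:~R :> R by rewrite -rmorphN opprB.
apply/eqP; rewrite eq_complex /=; apply/andP; split; apply/eqP.
  by congr (_ * _); apply: eq_Rintegral => t _; rewrite mulNr cosN.
rewrite opprK -mulrN; congr (_ * _); rewrite -[LHS]mulN1r -RintegralZl //; last first.
  apply: continuous_integrable_itv => t; apply: cvgM; first exact: cb.
  exact: continuous_sinM.
by apply: eq_Rintegral => t _; rewrite mulN1r mulNr sinN mulrN.
Qed.

Lemma Re_sum (I : Type) (r : seq I) (F : I -> C) :
  complex.Re (\sum_(i <- r) F i) = \sum_(i <- r) complex.Re (F i).
Proof. by apply: (big_morph (@complex.Re R)) => // [[? ?] [? ?]]. Qed.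

(** For a real vector [x], only the real parts of the two sides of [hermitian_rayleigh] are
    compared, so the sine part of each Fourier coefficient drops out. Linearity then moves the
    double sum under the integral. *)
Lemma toeplitz_rayleigh n (b : R -> R) (l : R) (x : 'I_n -> R) :
  continuous b -> smallest_eigenvalue (toeplitz n b) l ->
  l * \sum_j x j ^+ 2 <= (2 * pi)^-1 * \int[mu]_(t in `[- pi, pi])
    (b t * \sum_j \sum_k x j * x k * cos ((j%:R - k%:R) * t)).
Proof.
move=> cb hl; have hA := toeplitz_hermitian n cb.
have := hermitian_rayleigh hA hl (\row_j (x j)%:C%C).
rewrite lecE => /andP[_].
have -> : complex.Re (l%:C%C * ((\row_j (x j)%:C%C) *m (\row_j (x j)%:C%C)^t*) 0 0) =
   l * \sum_j x j ^+ 2.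
  rewrite !mxE mulr_sumr Re_sum mulr_sumr; apply: eq_bigr => j _.
  by rewrite !mxE /= ?(mul0r, mulr0, oppr0, addr0, subr0) expr2.
move=> /le_trans; apply.
rewrite mxE Re_sum.
rewrite [leRHS](_ : _ = \sum_k \sum_j x j * x k * ((2 * pi)^-1 *
   \int[mu]_(t in `[- pi, pi]) (b t * cos ((j%:R - k%:R) * t)))).
  apply: ler_sum => k _; rewrite !mxE mulr_suml Re_sum.
  apply: ler_sum => j _; rewrite !mxE fourier_coefE //=.
  rewrite rmorphB /= !pmulrn /=.
  by rewrite ?(mul0r, mulr0, oppr0, addr0, subr0) mulrAC.
have ci j k : mu.-integrable `[- pi, pi]
    (EFin \o (fun t => b t * cos ((j%:R - k%:R) * t))).
  apply: continuous_integrable_itv => t; apply: cvgM; first exact: cb.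
  exact: continuous_cosM.
have cxi (j k : 'I_n) : mu.-integrable `[- pi, pi]
    (EFin \o (fun t => x j * x k * (b t * cos ((j%:R - k%:R) * t)))).
  apply: continuous_integrable_itv => t; apply: cvgM; first exact: cvg_cst.
  by apply: cvgM; [exact: cb|exact: continuous_cosM].
under eq_Rintegral.
  move=> t _; rewrite mulr_sumr; under eq_bigr.
    move=> j _; rewrite mulr_sumr; under eq_bigr do rewrite mulrCA.
    over.
  over.
rewrite Rintegral_sum //; last first.
  move=> j; apply: continuous_integrable_itv; apply: continuous_sumr => k t.
  apply: cvgM; first exact: cvg_cst.
  by apply: cvgM; [exact: cb|exact: continuous_cosM].
rewrite exchange_big mulr_sumr; apply: eq_bigr => j _.
rewrite Rintegral_sum // mulr_sumr; apply: eq_bigr => k _.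
by rewrite RintegralZl // mulrCA.
Qed.

End toeplitz_form.

(** * The Dirichlet eigenvector *)

Section dirichlet_vector.
Variable R : realType.

(* The entries of the Dirichlet eigenvector of the discrete Laplacian, with
   indices centred at (n - 1) / 2. *)
Definition laplace_vector (n : nat) (j : nat) : R :=
  cos ((j%:R - (n%:R - 1) / 2) * (pi / n.+1%:R)).

Lemma cosD_cosB (x y : R) : cos (x + y) + cos (x - y) = 2 * (cos x * cos y).
Proof. by rewrite cosD cosB; ring. Qed.

Lemma sinD_sinB (x y : R) : sin (x + y) - sin (x - y) = 2 * (cos x * sin y).
Proof. by rewrite sinD sinB; ring. Qed.

Lemma cos_piBl (x : R) : cos (pi / 2 - x) = sin x.
Proof. by rewrite cosB cos_pihalf sin_pihalf mul0r add0r mul1r. Qed.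

Lemma sin_piBl (x : R) : sin (pi - x) = sin x.
Proof. by rewrite sinB sinpi cospi mul0r mulN1r opprK add0r. Qed.

Lemma sin_pi_div_gt0 n : (0 < n)%N -> 0 < sin (pi / n.+1%:R : R).
Proof.
move=> n0; apply: sin_gt0_pi; rewrite divr_gt0 ?pi_gt0 //=.
by rewrite ltr_pdivrMr // ltr_pMr ?pi_gt0 // ltr1n.
Qed.

(** The double angle formula reduces the sum of squares to a cosine sum with step [2 * al].
    Multiplied by [2 * sin al], that sum telescopes to [2 * sin (n * al)], which equals [2 * sin al]
    because [n * al = pi - al]. *)
Lemma laplace_vector_norm n : (0 < n)%N ->
  \sum_(j < n) laplace_vector n j ^+ 2 = n.+1%:R / 2 :> R.
Proof.
move=> n0; set al : R := pi / n.+1%:R.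
have al0 : sin al != 0 by rewrite gt_eqF // sin_pi_div_gt0.
have nal : n%:R * al = pi - al.
  by rewrite /al; field; rewrite nat1r pnatr_eq0.
suff S1 : \sum_(j < n) cos ((2 * j%:R - (n%:R - 1)) * al) = 1.
  rewrite (eq_bigr (fun j : 'I_n =>
    2^-1 + 2^-1 * cos ((2 * j%:R - (n%:R - 1)) * al))); last first.
    move=> j _; rewrite /laplace_vector -/al.
    have -> : (2 * j%:R - (n%:R - 1)) * al = ((j%:R - (n%:R - 1) / 2) * al) *+ 2.
      by rewrite mulr2n; field.
    by rewrite cos_mulr2n mulr2n; field.
  rewrite big_split /= sumr_const card_ord -mulr_sumr S1 -mulr_natl.
  by rewrite -natr1; field.
apply: (@mulfI _ (2 * sin al)); first by rewrite mulf_neq0.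
pose F (j : nat) := sin ((2 * j%:R - n%:R) * al).
rewrite mulr_sumr -(big_mkord xpredT (fun j => 2 * sin al *
  cos ((2 * j%:R - (n%:R - 1)) * al))) (eq_bigr (fun j => F j.+1 - F j)); last first.
  move=> j _; rewrite -mulrA [sin al * _]mulrC -sinD_sinB /F -natr1.
  by congr (sin _ - sin _); ring.
rewrite telescope_sumr // /F mulr0 sub0r mulNr sinN opprK.
rewrite (_ : (2 * n%:R - n%:R) * al = n%:R * al); last by ring.
by rewrite nal sin_piBl; ring.
Qed.

(** A Christoffel-Darboux argument: two solutions of the three-term recurrence [ZS], at the
    frequencies [al] and [t], have a discrete Wronskian [F] whose increments are the summands times
    [2 * (cos t - cos al)]. The sum telescopes to boundary terms. *)
Lemma laplace_vector_cos n (t : R) :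
  (\sum_(j < n) laplace_vector n j * cos ((j%:R - (n%:R - 1) / 2) * t)) *
    (cos t - cos (pi / n.+1%:R)) =
  sin (pi / n.+1%:R) * cos (n.+1%:R * t / 2).
Proof.
set al : R := pi / n.+1%:R.
have al2 : n.+1%:R / 2 * al = pi / 2.
  by rewrite /al; field; rewrite nat1r pnatr_eq0.
(* The index is shifted by one: entry [j] of the vector is [Z al j.+1], and the Dirichlet conditions
   become [Z al 0 = Z al n.+1 = 0]. *)
pose Z (s : R) (i : nat) := cos ((i%:R - n.+1%:R / 2) * s).
pose F (i : nat) := Z al i * Z t i.+1 - Z al i.+1 * Z t i.
have ZS s i : Z s i + Z s i.+2 = 2 * (Z s i.+1 * cos s).
  rewrite addrC -cosD_cosB /Z.
  by congr (cos _ + cos _); rewrite -!natr1; ring.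
apply: (@mulfI _ 2) => //.
have -> : 2 * ((\sum_(j < n) laplace_vector n j *
    cos ((j%:R - (n%:R - 1) / 2) * t)) * (cos t - cos al)) =
    \sum_(0 <= j < n) (F j.+1 - F j).
  rewrite big_mkord mulr_suml mulr_sumr; apply: eq_bigr => j _.
  have -> : laplace_vector n j = Z al j.+1.
    by rewrite /laplace_vector -/al /Z -!natr1; congr cos; field.
  have -> : cos ((j%:R - (n%:R - 1) / 2) * t) = Z t j.+1.
    by rewrite /Z -!natr1; congr cos; field.
  rewrite /F.
  have := ZS al j; have := ZS t j => h1 h2.
  have -> : Z al j.+2 = 2 * (Z al j.+1 * cos al) - Z al j by rewrite -h2; ring.
  have -> : Z t j.+2 = 2 * (Z t j.+1 * cos t) - Z t j by rewrite -h1; ring.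
  by ring.
rewrite telescope_sumr // /F.
have -> : Z al n.+1 = 0.
  by rewrite /Z -cos_pihalf -al2; congr cos; field.
have -> : Z al 0%N = 0 by rewrite /Z sub0r mulNr cosN al2 cos_pihalf.
have -> : Z al n = sin al.
  by rewrite /Z -cos_piBl -al2; congr cos; field.
have -> : Z al 1%N = sin al.
  by rewrite /Z -cos_piBl -al2 -[RHS]cosN; congr cos; rewrite -natr1; field.
have -> : Z t n.+1 = cos (n.+1%:R * t / 2).
  by rewrite /Z; congr cos; field.
have -> : Z t 0%N = cos (n.+1%:R * t / 2).
  by rewrite /Z -[RHS]cosN; congr cos; field.
ring.
Qed.

(** Reversing the indices negates the centred index, under which the vector is even and the sine is
    odd; the sum is therefore its own opposite. *)
Lemma laplace_vector_sin n (t : R) :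
  \sum_(j < n) laplace_vector n j * sin ((j%:R - (n%:R - 1) / 2) * t) = 0.
Proof.
set S := LHS; apply: (@mulfI _ 2) => //; rewrite mulr0.
have -> : 2 * S = S + S by ring.
rewrite {2}/S (reindex_inj rev_ord_inj) /S -big_split /= big1 // => j _.
have h : (n - j.+1)%:R - (n%:R - 1) / 2 = - (j%:R - (n%:R - 1) / 2) :> R.
  by rewrite natrB // -natr1; field.
by rewrite /laplace_vector h !mulNr cosN sinN mulrN subrr.
Qed.

(** Expanding [cos] of the difference of centred angles gives a product of cosine sums plus a
    product of sine sums, and the latter vanishes by [laplace_vector_sin]. *)
Lemma laplace_vector_form n (t : R) :
  \sum_(j < n) \sum_(k < n) laplace_vector n j * laplace_vector n k *
    cos ((j%:R - k%:R) * t) =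
  (\sum_(j < n) laplace_vector n j * cos ((j%:R - (n%:R - 1) / 2) * t)) ^+ 2.
Proof.
set c := (n%:R - 1) / 2.
have /(congr1 (fun s => s * s)) := laplace_vector_sin n t.
rewrite mulr0 -/c big_distrlr /= => S0; rewrite expr2 big_distrlr /=.
rewrite -[RHS]addr0 -[X in _ = _ + X]S0 -big_split; apply: eq_bigr => j _ /=.
rewrite -big_split; apply: eq_bigr => k _ /=.
have -> : (j%:R - k%:R) * t = (j%:R - c) * t - (k%:R - c) * t by ring.
by rewrite cosB; ring.
Qed.

End dirichlet_vector.

(** * Pointwise estimates *)

Section pointwise.
Variable R : realType.
Implicit Types (n : nat) (u x y : R).

Lemma sin_mean_value x : 0 < x -> exists2 c, 0 < c < x & sin x = cos c * x.
Proof.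
move=> x0.
have [c] := @MVT R sin cos 0 x x0 (fun z _ => is_derive_sin z)
  (continuous_subspaceT (@continuous_sin R)).
by rewrite in_itv /= sin0 !subr0 => hc ->; exists c.
Qed.

Lemma sin_lex x : 0 <= x -> sin x <= x.
Proof.
rewrite le_eqVlt => /predU1P[<-|x0]; first by rewrite sin0.
have [c _ ->] := sin_mean_value x0.
by rewrite ler_piMl ?cos_le1 ?ltW.
Qed.

Lemma norm_sin_le x : `|sin x| <= `|x|.
Proof.
wlog x0 : x / 0 <= x.
  move=> h; have [/h//|/ltW x0] := leP 0 x.
  by rewrite -normrN -sinN -[leRHS]normrN h ?oppr_ge0.
have [xpi|xpi] := leP x pi; last first.
  by rewrite (le_trans (sin_max x)) // ger0_norm // (le_trans _ (ltW xpi)) //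
    (le_trans _ (pi_ge2 R)) // ler1n.
by rewrite !ger0_norm ?sin_lex ?sin_ge0_pi ?x0.
Qed.

(** The mean value theorem gives [sin x = x * cos c] with [c < x], and cosine decreases on
    [[0, pi]]. *)
Lemma mul_cos_le_sin x : 0 <= x <= pi -> x * cos x <= sin x.
Proof.
move=> /andP[]; rewrite le_eqVlt => /predU1P[<- _|x0 xpi].
  by rewrite mul0r sin0.
have [c /andP[c0 cx] ->] := sin_mean_value x0.
rewrite mulrC ler_pM2r // ltW // ltr_cos // in_itv /= ?(ltW x0) ?(ltW c0) //.
exact: ltW (lt_le_trans cx xpi).
Qed.

(** This is [mul_cos_le_sin] at the half angle. Unlike [x * cos x], the lower bound stays
    nonnegative up to [pi], so it can be multiplied and squared. *)
Lemma mul_cos2_le_sin x : 0 <= x <= pi -> x * cos (x / 2) ^+ 2 <= sin x.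
Proof.
move=> /andP[x0 xpi].
have -> : sin x = 2 * (cos (x / 2) * sin (x / 2)).
  by rewrite mulr_natl -sin_mulr2n; congr sin; rewrite mulr2n; field.
have -> : x * cos (x / 2) ^+ 2 = 2 * (cos (x / 2) * (x / 2 * cos (x / 2))) by field.
rewrite ler_pM2l // ler_wpM2l //; last first.
  by apply: mul_cos_le_sin; rewrite divr_ge0 //=; lra.
by apply: cos_ge0_pihalf; rewrite ler_pM2r ?invr_gt0 // xpi andbT; lra.
Qed.

(** The difference of cosines is, up to sign, [2 * sin a * sin b] with [a] and [b] as set below.
    Each sine is bounded below by [mul_cos2_le_sin], and [cos (b / 2)] is weakened to [cos (a / 2)]
    since [b <= a]; squaring produces the eighth power. *)
Lemma sqr_cosB_ge (m : nat) u : (1 < m)%N -> 0 <= u <= pi * m%:R ->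
  (u ^+ 2 - pi ^+ 2) ^+ 2 / (4 * m%:R ^+ 4) * cos ((u + pi) / (4 * m%:R)) ^+ 8 <=
  (cos (u / m%:R) - cos (pi / m%:R)) ^+ 2.
Proof.
move=> m1 /andP[u0 um]; have pi0 := pi_gt0 R.
have m0 : 0 < m%:R :> R by rewrite ltr0n ltnW.
have m2 : 2 <= m%:R :> R by rewrite ler_nat.
set a := (u + pi) / (2 * m%:R); set b := `|u - pi| / (2 * m%:R).
have b0 : 0 <= b by rewrite divr_ge0 // mulr_ge0 // ltW.
have ba : b <= a.
  by rewrite ler_pM2r ?invr_gt0 ?mulr_gt0 // ler_norml; lra.
have api : a <= pi.
  by rewrite ler_pdivrMr ?mulr_gt0 //; nra.
have -> : (u + pi) / (4 * m%:R) = a / 2 by rewrite /a; field; lra.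
have -> : (u ^+ 2 - pi ^+ 2) ^+ 2 / (4 * m%:R ^+ 4) = 4 * (a * b) ^+ 2.
  rewrite exprMn [b ^+ 2]exprMn real_normK ?num_real // /a; field; lra.
have -> : (cos (u / m%:R) - cos (pi / m%:R)) ^+ 2 = 4 * (sin a * sin b) ^+ 2.
  have -> : (sin a * sin b) ^+ 2 = (sin a * sin ((u - pi) / (2 * m%:R))) ^+ 2.
    by rewrite /b; case: ger0P => _; rewrite ?mulNr ?sinN ?mulrN ?sqrrN.
  rewrite -[u / _ in LHS](_ : a + (u - pi) / (2 * m%:R) = _); last first.
    by rewrite /a; field; lra.
  rewrite -[pi / _ in LHS](_ : a - (u - pi) / (2 * m%:R) = _); last first.
    by rewrite /a; field; lra.
  by rewrite cosD cosB; ring.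
rewrite -[leLHS]mulrA ler_pM2l //.
have -> : (a * b) ^+ 2 * cos (a / 2) ^+ 8 =
  ((a * cos (a / 2) ^+ 2) * (b * cos (a / 2) ^+ 2)) ^+ 2 by ring.
have a0 : 0 <= a by exact: le_trans ba.
have c0 := sqr_ge0 (cos (a / 2)).
have ac0 := mulr_ge0 a0 c0; have bc0 := mulr_ge0 b0 c0.
rewrite ler_sqr ?nnegrE; last 2 first.
- exact: mulr_ge0.
- by rewrite mulr_ge0 // sin_ge0_pi // ?a0 // b0 (le_trans ba).
apply: ler_pM => //; first by rewrite mul_cos2_le_sin // a0.
have b0pi : 0 <= b <= pi by rewrite b0 (le_trans ba).
apply: le_trans (mul_cos2_le_sin b0pi); rewrite ler_wpM2l //.
rewrite ler_sqr ?nnegrE ?cos_ge0_pihalf //; last 2 first.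
- by apply/andP; split; lra.
- by apply/andP; split; lra.
move: ba; rewrite le_eqVlt => /predU1P[->//|ba].
by rewrite ltW // ltr_cos ?in_itv /=; lra.
Qed.

(** Both signs of [y] follow from [1 + x <= expR x], taken at [y] or at [- y]. *)
Lemma expR_quotient_le y : y != 0 -> y / (1 - expR (- y)) <= 1 + Num.max 0 y.
Proof.
move=> y0; have [yp|yn] := ltP 0 y.
  have e1 : 1 + y <= expR y by exact: expR_ge1Dx.
  have e : expR (- y) <= (1 + y)^-1.
    by rewrite expRN lef_pV2 // posrE; lra.
  rewrite ler_pdivrMr; last first.
    by rewrite subr_gt0 expR_lt1; lra.
  have : expR (- y) * (1 + y) <= 1 by rewrite -ler_pdivlMr ?div1r //; lra.
  by rewrite mulrBr mulr1 [expR _ * _]mulrC; lra.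
have {y0}yn : y < 0 by rewrite lt_neqAle y0.
have e : 1 - y <= expR (- y) by exact: expR_ge1Dx.
rewrite addr0 ler_ndivrMr; last by lra.
by lra.
Qed.

(** Divided by [n], the left side is a Riemann sum of the integral of [u ^ s] over [s] in [[1, 2]],
    that is of [(u ^+ 2 - u) / ln u]. It is geometric of ratio [q = expR (- y)] with
    [q ^+ n = u^-1], so the error factor is exactly [y / (1 - q)], which is at most [1 + u / n]
    because [ln u < u]. *)
Lemma geometric_symbol_le n u : (0 < n)%N -> 0 < u -> u != 1 ->
  \sum_(j < n) u `^ (2 - j%:R / n%:R) <=
  n%:R * (1 + u / n%:R) * ((u ^+ 2 - u) / ln u).
Proof.
move=> n0 u0 u1; have n0' : 0 < n%:R :> R by rewrite ltr0n.
have L0 : ln u != 0 by rewrite ln_eq0.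
set y := ln u / n%:R.
have y0 : y != 0 by rewrite mulf_neq0 ?invr_neq0 // gt_eqF.
set q := expR (- y).
have q1 : 1 - q != 0.
  by rewrite subr_eq0 eq_sym -expR0 (inj_eq (@expR_inj R)) oppr_eq0.
have qn : q ^+ n = u^-1.
  rewrite /q -expRM_natl mulrN mulrC /y divfK ?gt_eqF // expRN lnK //.
have -> : \sum_(j < n) u `^ (2 - j%:R / n%:R) = (u ^+ 2 - u) / (1 - q).
  apply: (@mulIf _ (1 - q)) => //; rewrite divfK // mulrC.
  have -> : \sum_(j < n) u `^ (2 - j%:R / n%:R) = u ^+ 2 * \sum_(j < n) q ^+ j.
    rewrite mulr_sumr; apply: eq_bigr => j _.
    rewrite powRB ?(gt_eqF u0) ?implybT // powR_mulrn ?ltW //; congr (_ * _).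
    rewrite /q -expRM_natl mulrN expRN /powR gt_eqF //; congr (expR _)^-1.
    by rewrite /y; field; rewrite gt_eqF.
  rewrite mulrCA -opprB mulNr -subrX1 qn.
  by rewrite /=; field; rewrite gt_eqF.
have -> : (u ^+ 2 - u) / (1 - q) = n%:R * (y / (1 - q)) * ((u ^+ 2 - u) / ln u).
  by rewrite /y; field; rewrite L0 q1 gt_eqF.
have quot0 : 0 <= (u ^+ 2 - u) / ln u.
  have -> : u ^+ 2 - u = u * (u - 1) by ring.
  rewrite -mulrA mulr_ge0 ?(ltW u0) //.
  case: (ltgtP u 1) u1 => // hu _.
    by rewrite mulr_le0 ?invr_le0 ?ln_le0 ?subr_le0 ?ltW.
  by rewrite divr_ge0 ?ln_ge0 ?subr_ge0 ?ltW.
rewrite ler_wpM2r // ler_pM2l // (le_trans (expR_quotient_le y0)) // lerD2l.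
rewrite ge_max divr_ge0 ?(ltW u0) ?(ltW n0') //= ler_pM2r ?invr_gt0 //.
by rewrite ltW // ln_sublinear.
Qed.

(** The exponents of the absolute value are nonnegative, so [u / m] may be enlarged to [u / n]. The
    powers of [1 / n] in each term then combine to [n^-2] and leave the geometric sum. The case
    [m = n.+1] matches the scale of the Dirichlet eigenvector. *)
Lemma symbol_div_le n (m : nat) u : (0 < n <= m)%N -> 0 < u -> u != 1 ->
  symbol n (u / m%:R) <= n%:R^-1 * (1 + u / n%:R) * ((u ^+ 2 - u) / ln u).
Proof.
move=> /andP[n0 nm] u0 u1; have n0' : 0 < n%:R :> R by rewrite ltr0n.
have m0' : 0 < m%:R :> R by rewrite ltr0n (leq_trans n0).
have -> : n%:R^-1 * (1 + u / n%:R) * ((u ^+ 2 - u) / ln u) =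
  n%:R^-1 ^+ 2 * (n%:R * (1 + u / n%:R) * ((u ^+ 2 - u) / ln u)).
  by rewrite expr2 !mulrA mulfVK ?gt_eqF.
apply: le_trans (ler_wpM2l _ (geometric_symbol_le n0 u0 u1)); last first.
  by rewrite sqr_ge0.
rewrite mulr_sumr; apply: ler_sum => j _.
have jn : 0 <= 2 - j%:R / n%:R :> R.
  rewrite subr_ge0 ler_pdivrMr // -natrM ler_nat.
  by rewrite (leq_trans (ltnW (ltn_ord j))) // leq_pmull.
have -> : n%:R^-1 ^+ 2 * u `^ (2 - j%:R / n%:R) =
    n%:R^-1 `^ (j%:R / n%:R) * (u / n%:R) `^ (2 - j%:R / n%:R) :> R.
  rewrite powRM ?invr_ge0 ?ler0n ?(ltW u0) // mulrCA [RHS]mulrC; congr (_ * _).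
  rewrite -powR_mulrn ?invr_ge0 ?ler0n // -powRD; last first.
    by rewrite invr_eq0 (gt_eqF n0') implybT.
  by congr (_ `^ _); ring.
rewrite ler_wpM2l ?powR_ge0 // ge0_ler_powR // ?nnegrE ?normr_ge0 //.
  by rewrite divr_ge0 // ltW.
rewrite ger0_norm; last by rewrite divr_ge0 // ltW.
by rewrite ler_pM2l // lef_pV2 ?posrE // ler_nat.
Qed.

End pointwise.

(** * Continuity of the symbol and changes of variable *)

Section integrals.
Variable R : realType.
Local Notation mu := (@lebesgue_measure R).

Lemma continuous_norm_powR (p : R) : 0 < p ->
  continuous (fun t : R => `|t| `^ p).
Proof.
move=> p0 t; have [->|t0] := eqVneq t 0.
  rewrite /continuous_at /= normr0 powR0 ?gt_eqF //; apply/cvgr0Pnorm_lt => e e0.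
  near=> s; rewrite ger0_norm ?powR_ge0 //.
  have -> : e = (e `^ p^-1) `^ p by rewrite -powRrM mulVf ?gt_eqF // powRr1 // ltW.
  rewrite gt0_ltr_powR // ?nnegrE ?normr_ge0 ?powR_ge0 //.
  near: s; apply: cvgr0_norm_lt; [exact: cvg_id|exact: powR_gt0].
(* Away from 0 the power is differentiable; only the origin required a direct estimate. *)
apply: (@continuous_comp _ _ _ (fun t : R => `|t|) (fun s => s `^ p)).
  exact: norm_continuous.
apply: differentiable_continuous; apply/derivable1_diffP.
by apply: derivable_powR; rewrite in_itv /= normr_gt0 t0.
Unshelve. all: end_near. Qed.

Lemma continuous_symbol n : (0 < n)%N -> continuous (@symbol R n).
Proof.
move=> n0; apply: continuous_sumr => j t.
apply: cvgM; first exact: cvg_cst.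
apply: continuous_norm_powR; rewrite subr_gt0 ltr_pdivrMr ?ltr0n // -natrM.
by rewrite ltr_nat (leq_trans (ltn_ord j)) // leq_pmull.
Qed.

Lemma Rintegral_scale (g : R -> R) (a m : R) : 0 <= a -> 0 < m ->
  continuous g ->
  \int[mu]_(t in `[0, a]) g t =
  m^-1 * \int[mu]_(u in `[0, a * m]) g (u / m).
Proof.
move=> a0 m0 cg.
have dF (u : R) : is_derive u 1 (fun u : R => u / m) m^-1.
  by apply: is_derive_eq; rewrite scaler0 add0r /GRing.scale /= mulr1.
have dFE : derive1 (fun u : R => u / m) = cst m^-1.
  by apply/funext => u; rewrite derive1E derive_val.
have cF : continuous (fun u : R => u / m).
  by move=> u; apply: cvgM; [exact: cvg_id|exact: cvg_cst].
have cgF : continuous (fun u : R => g (u / m)).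
  by move=> u; apply: (continuous_comp (cF u) (cg _)).
rewrite -RintegralZl //; last exact: continuous_integrable_itv.
rewrite /Rintegral; congr fine.
have := @integration_by_substitution_increasing R (fun u : R => u / m) g 0 (a * m).
rewrite mul0r mulfK ?gt_eqF // => ->.
- by apply: eq_integral => u _; rewrite dFE /= mulrC.
- by rewrite mulr_ge0 // ltW.
- by move=> x y _ _ xy; rewrite ltr_pM2r // invr_gt0.
- by rewrite dFE => x _; exact: cvg_cst.
- by rewrite dFE; exact: is_cvg_cst.
- by rewrite dFE; exact: is_cvg_cst.
- split.
  + by move=> x _; exact: ex_derive.
  + by apply: cvg_at_right_filter; exact: cF.
  + by apply: cvg_at_left_filter; exact: cF.
- exact: continuous_subspaceT.
Qed.

Lemma Rintegral_even (g : R -> R) (a : R) : 0 <= a -> continuous g ->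
  (forall t, g (- t) = g t) ->
  \int[mu]_(t in `[- a, a]) g t = 2 * \int[mu]_(t in `[0, a]) g t.
Proof.
move=> a0 cg ge.
have ig b c : mu.-integrable `[b, c] (EFin \o g) by exact: continuous_integrable_itv.
have := @Rintegral_itvB R g (BLeft (- a)) (BRight a) 0 (ig _ _).
rewrite !bnd_simp oppr_le0 a0 => /(_ isT isT) /eqP.
rewrite subr_eq => /eqP ->.
rewrite Rintegral_itv_obnd_cbnd; last first.
  by apply: integrableS (ig 0 a) => //; exact: subset_itv_oc_cc.
have -> : \int[mu]_(t in `[(- a), 0]) g t = \int[mu]_(t in `[0, a]) g t.
  rewrite -[X in `[- a, X]]oppr0 /Rintegral integration_by_substitution_oppr //.
    by congr fine; apply: eq_integral => t _ /=; rewrite ge.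
  exact: continuous_subspaceT.
by ring.
Qed.

End integrals.

(** * The two integrals defining k1 *)

Section limit_integrand.
Variable R : realType.
Local Notation mu := (@lebesgue_measure R).

Implicit Types u K : R.

Definition norm_density (u : R) : R :=
  cos (u / 2) ^+ 2 / (u ^+ 2 - pi ^+ 2) ^+ 2.

Definition energy_density (u : R) : R :=
  (u ^+ 2 - u) / (u ^+ 2 - pi ^+ 2) ^+ 2 * (cos (u / 2) ^+ 2 / ln u).

Lemma ler_sqr_norm (x y : R) : `|x| <= `|y| -> x ^+ 2 <= y ^+ 2.
Proof.
by rewrite -(real_normK (num_real x)) -(real_normK (num_real y)) ler_sqr ?nnegrE.
Qed.

Lemma energy_densityE u :
  energy_density u = norm_density u * ((u ^+ 2 - u) / ln u).
Proof. by rewrite /energy_density /norm_density; ring. Qed.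

Lemma norm_density_ge0 u : 0 <= norm_density u.
Proof. by rewrite divr_ge0 // sqr_ge0. Qed.

(** Writing [cos (u / 2)] as [sin ((pi - u) / 2)] shows a zero at [pi] that cancels the double zero
    of the denominator. *)
Lemma norm_density_le u : 0 <= u -> norm_density u <= (4 * (u + pi) ^+ 2)^-1.
Proof.
move=> u0; have pi0 := pi_gt0 R; have up : 0 < u + pi by lra.
rewrite /norm_density; have [->|upi] := eqVneq u pi.
  (* At [u = pi] the inverse of 0 is 0, so the density takes the value 0 rather than its limit. *)
  by rewrite subrr expr0n invr0 mulr0 invr_ge0 mulr_ge0 // sqr_ge0.
have upi0 : (u - pi) ^+ 2 > 0 by rewrite exprn_even_gt0 //= subr_eq0.
have -> : (u ^+ 2 - pi ^+ 2) ^+ 2 = (u - pi) ^+ 2 * (u + pi) ^+ 2 by ring.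
have -> : cos (u / 2) = sin ((pi - u) / 2).
  by rewrite -cos_piBl; congr cos; field.
rewrite ler_pdivrMr; last by rewrite mulr_gt0 // exprn_gt0.
have -> : (4 * (u + pi) ^+ 2)^-1 * ((u - pi) ^+ 2 * (u + pi) ^+ 2) =
   ((pi - u) / 2) ^+ 2 by field; lra.
exact/ler_sqr_norm/norm_sin_le.
Qed.

Lemma ln_ratio_ge0 u : 0 <= u -> 0 <= (u ^+ 2 - u) / ln u.
Proof.
rewrite le_eqVlt => /predU1P[<-|u0]; first by rewrite expr0n subrr mul0r.
have -> : u ^+ 2 - u = u * (u - 1) by ring.
rewrite -mulrA mulr_ge0 ?(ltW u0) //.
have [hu|hu] := leP 1 u; first by rewrite divr_ge0 ?ln_ge0 // subr_ge0.
by rewrite mulr_le0 ?invr_le0 ?ln_le0 ?subr_le0 ?ltW.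
Qed.

Lemma ln_leB1 u : 0 < u -> ln u <= u - 1.
Proof.
by move=> u0; have := @le_ln1Dx R (u - 1); rewrite [1 + _]addrC subrK; apply; lra.
Qed.

(** For [u < 1] this comes from [ln u <= u - 1], for [u > 1] from the same inequality at [u^-1],
    that is [1 - u^-1 <= ln u]. At 1 the quotient is 0 by the convention on inverses. *)
Lemma ln_ratio_le u : 0 <= u -> (u ^+ 2 - u) / ln u <= u ^+ 2 + u.
Proof.
rewrite le_eqVlt => /predU1P[<-|u0]; first by rewrite expr0n subrr mul0r addr0.
have h1 := ln_leB1 u0.
have h2 : 1 - u^-1 <= ln u.
  by have := @ln_leB1 u^-1; rewrite invr_gt0 lnV ?posrE // => /(_ u0); lra.
have uv : u * u^-1 = 1 by rewrite divff // gt_eqF.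
have [hu|hu|->] := ltgtP u 1.
- have l0 : ln u < 0 by rewrite ln_lt0 // u0.
  by rewrite ler_ndivrMr //; nra.
- have l0 : 0 < ln u by rewrite ln_gt0.
  rewrite ler_pdivrMr //.
  have : u ^+ 2 * (1 - u^-1) <= u ^+ 2 * ln u by rewrite ler_pM2l // exprn_gt0.
  have -> : u ^+ 2 * (1 - u^-1) = u ^+ 2 - u by field; lra.
  by nra.
- by rewrite ln1 invr0 mulr0; lra.
Qed.

Lemma energy_density_ge0 u : 0 <= u -> 0 <= energy_density u.
Proof.
by move=> u0; rewrite energy_densityE mulr_ge0 ?norm_density_ge0 ?ln_ratio_ge0.
Qed.

(** The cut is at 8. Below it, [u ^+ 2 + u <= (u + pi) ^+ 2] and [1 + u ^+ 2 <= 65 <= 4 * 17]. Above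
    it, [pi < 4] gives [u ^+ 2 - pi ^+ 2 >= 48 / 64 * u ^+ 2], and the squared cosine is bounded by
    1. *)
Lemma energy_density_le u : 0 <= u -> energy_density u <= 17 * (oneDsqr u)^-1.
Proof.
move=> u0; have := pi_gt0 R; have := pi_ge2 R; have := pihalf_lt2 R => p2 p1 p0.
have d0 : 0 < oneDsqr u by rewrite /oneDsqr; nra.
rewrite energy_densityE.
have r0 := ln_ratio_ge0 u0; have rle := ln_ratio_le u0.
have c0 := norm_density_ge0 u.
apply: le_trans (ler_wpM2l c0 rle) _; rewrite ler_pdivlMr //.
have [u8|u8] := leP u 8.
  apply: (@le_trans _ _ ((4 * (u + pi) ^+ 2)^-1 * (u ^+ 2 + u) * oneDsqr u)).
    rewrite ler_pM2r // ler_wpM2r ?norm_density_le //; nra.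
  rewrite [_^-1 * _]mulrC mulrAC ler_pdivrMr; last by nra.
  have -> : 17 * (4 * (u + pi) ^+ 2) = (u + pi) ^+ 2 * 68 by ring.
  by rewrite /oneDsqr; apply: ler_pM; nra.
apply: (@le_trans _ _ ((u ^+ 2 - pi ^+ 2) ^- 2 * (u ^+ 2 + u) * oneDsqr u)).
  rewrite ler_pM2r // ler_wpM2r //; first by nra.
  by rewrite ler_piMl ?invr_ge0 ?sqr_ge0 //.
have q0 : 48 / 64 * u ^+ 2 <= u ^+ 2 - pi ^+ 2 by nra.
have q1 : 0 < u ^+ 2 - pi ^+ 2 by nra.
rewrite [_^-1 * _]mulrC mulrAC ler_pdivrMr; last by rewrite exprn_gt0.
rewrite /oneDsqr.
apply: (@le_trans _ _ (17 * (48 / 64 * u ^+ 2) ^+ 2)).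
  by nra.
by rewrite ler_pM2l // ler_sqr ?nnegrE; nra.
Qed.

(** On nonnegative reals, 0 included, the inverse agrees with the real power of exponent -1, which
    is measurable. *)
Lemma measurable_inv_sqr (f : R -> R) : measurable_fun setT f ->
  measurable_fun setT (fun x => (f x ^+ 2)^-1).
Proof.
move=> mf; apply: (eq_measurable_fun (fun x => (f x ^+ 2) `^ (-1))).
  by move=> x _; rewrite powR_inv1 // sqr_ge0.
apply: (@measurableT_comp _ _ _ _ _ _ (@powR R ^~ (-1))).
  exact: measurable_powR.
exact: measurable_funX.
Qed.

Lemma measurable_norm_density : measurable_fun setT norm_density.
Proof.
apply: measurable_funM.
  apply: measurable_funX; apply: continuous_measurable_fun.
  by under eq_fun do rewrite mulrC; exact: continuous_cosM.
apply: measurable_inv_sqr; apply: measurable_funB; last exact: measurable_cst.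
exact: exprn_measurable.
Qed.

Lemma measurable_energy_density : measurable_fun setT energy_density.
Proof.
(* The inverse of [ln u] becomes [ln u] times the inverse of its square, so that
   [measurable_inv_sqr] applies; both are 0 where [ln u = 0]. *)
rewrite (_ : energy_density = fun u =>
    norm_density u * ((u ^+ 2 - u) * (ln u * (ln u ^+ 2)^-1))); last first.
  apply/funext => u; rewrite energy_densityE; congr (_ * (_ * _)).
  have [->|l0] := eqVneq (ln u) 0; first by rewrite mul0r invr0.
  by field.
apply: measurable_funM; first exact: measurable_norm_density.
apply: measurable_funM.
  by apply: measurable_funB; [exact: exprn_measurable|exact: measurable_id].
apply: measurable_funM; first exact: measurable_ln.
by apply: measurable_inv_sqr; exact: measurable_ln.
Qed.

Lemma integrable_oneDsqrV :
  mu.-integrable `[0, +oo[ (EFin \o (fun u : R => (oneDsqr u)^-1)).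
Proof.
apply/integrableP; split.
  apply/measurable_EFinP; apply: measurable_funTS.
  by apply: continuous_measurable_fun; exact: continuous_oneDsqrV.
under eq_integral do rewrite /= ger0_norm ?invr_ge0 //.
by rewrite integral0y_oneDsqr ltry.
Qed.

Lemma integrable_energy_density :
  mu.-integrable `[0, +oo[ (EFin \o energy_density).
Proof.
have h := integrableZl (mu := mu) (measurable_itv _) 17 integrable_oneDsqrV.
apply: le_integrable h => //.
- by apply/measurable_EFinP; apply: measurable_funTS; exact: measurable_energy_density.
- move=> u /=; rewrite in_itv /= andbT => u0.
  rewrite lee_fin ger0_norm ?energy_density_ge0 // ger0_norm.
    exact: energy_density_le.
  by rewrite (le_trans (energy_density_ge0 u0)) // energy_density_le.
Qed.

(** The majorant [17 / (1 + u ^+ 2)] has the explicit tail [17 * (pi / 2 - atan K)], which tends to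
    0. *)
Lemma energy_density_tail (K : R) : 0 <= K ->
  \int[mu]_(u in `]K, +oo[) energy_density u <= 17 * (pi / 2 - atan K).
Proof.
move=> K0.
have sub : `]K, +oo[ `<=` (`[0, +oo[ : set R).
  by move=> x /=; rewrite !in_itv /= !andbT => /ltW; exact: le_trans.
have intd := integrableS (mu := mu) (measurable_itv _) (measurable_itv _) sub
  integrable_oneDsqrV.
have -> : pi / 2 - atan K = \int[mu]_(u in `]K, +oo[) (oneDsqr u)^-1.
  rewrite -(Rintegral_itvB (a := BLeft 0) integrable_oneDsqrV) //.
  by rewrite integral0_oneDsqr // /Rintegral integral0y_oneDsqr.
rewrite -(RintegralZl (mu := mu) 17 (measurable_itv _) intd).
apply: le_Rintegral => //.
- exact: integrableS integrable_energy_density.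
- exact: (integrableZl (mu := mu) (measurable_itv _) 17 intd).
- by move=> u /sub /=; rewrite in_itv /= andbT; exact: energy_density_le.
Qed.

End limit_integrand.

(** * Positivity of both integrals and the strict gap below [k1] *)

Section constants.
Variable R : realType.
Local Notation mu := (@lebesgue_measure R).
Implicit Types u : R.

Lemma le_Rintegral_subset (A B : set R) (f : R -> R) :
  measurable A -> measurable B -> mu.-integrable B (EFin \o f) ->
  (forall u, B u -> 0 <= f u) -> A `<=` B ->
  \int[mu]_(u in A) f u <= \int[mu]_(u in B) f u.
Proof.
move=> mA mB intf f0 AB.
have intA : mu.-integrable A (EFin \o f) by exact: integrableS intf.
apply: fine_le.
- exact: integrable_fin_num intA.
- exact: integrable_fin_num intf.
- by apply: ge0_subset_integral => //; exact: measurable_int intf.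
Qed.

Lemma Rintegral_gt0 (D : set R) (f : R -> R) (p q k : R) :
  measurable D -> mu.-integrable D (EFin \o f) -> (forall u, D u -> 0 <= f u) ->
  `[p, q] `<=` D -> p < q -> 0 < k -> (forall u, p <= u <= q -> k <= f u) ->
  0 < \int[mu]_(u in D) f u.
Proof.
move=> mD intf f0 pqD pq k0 kf.
have intpq : mu.-integrable `[p, q] (EFin \o f) by exact: integrableS intf.
apply: (@lt_le_trans _ _ (\int[mu]_(u in `[p, q]) k)).
  rewrite Rintegral_cst //= lebesgue_measure_itv /= lte_fin pq.
  by rewrite /= mulr_gt0 // subr_gt0.
apply: (@le_trans _ _ (\int[mu]_(u in `[p, q]) f u)).
  apply: le_Rintegral => //.
  by apply: continuous_integrable_itv => u; exact: cvg_cst.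
exact: le_Rintegral_subset.
Qed.

Lemma pi_gt2 : 2 < pi :> R.
Proof.
rewrite lt_neqAle pi_ge2 andbT; apply/eqP => p2.
by have := @cos_pihalf R; rewrite -p2 divff // => /eqP; rewrite gt_eqF // cos1_gt0.
Qed.

(** The bound [15 / 8 < 2 < pi] keeps [u / 2] below 1 and [u] away from the zero of the denominator
    at [pi]. *)
Lemma norm_density_ge u : 0 <= u <= 15 / 8 -> cos 1 ^+ 2 / pi ^+ 4 <= norm_density u.
Proof.
move=> /andP[u0 u2]; have p2 := pi_gt2.
have c1 := cos1_gt0 R.
apply: ler_pM; rewrite ?sqr_ge0 ?invr_ge0 ?exprn_ge0 ?pi_ge0 //.
  have cu : cos 1 <= cos (u / 2) by rewrite ltW // ltr_cos // ?in_itv /=; lra.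
  by rewrite ler_sqr ?nnegrE // ltW // (lt_le_trans c1).
rewrite lef_pV2 ?posrE; last 2 first.
- by rewrite exprn_gt0 ?pi_gt0.
- by rewrite exprn_even_gt0 //= subr_eq0 lt_eqF //; nra.
have -> : pi ^+ 4 = (pi ^+ 2) ^+ 2 :> R by rewrite -exprM.
have -> : (u ^+ 2 - pi ^+ 2) ^+ 2 = (pi ^+ 2 - u ^+ 2) ^+ 2 :> R by ring.
by rewrite ler_sqr ?nnegrE; nra.
Qed.

Lemma cos1_div_pi_gt0 : 0 < cos 1 ^+ 2 / pi ^+ 4 :> R.
Proof. by rewrite divr_gt0 // exprn_gt0 ?cos1_gt0 ?pi_gt0. Qed.

Lemma energy_integral_gt0 : 0 < \int[mu]_(u in `[0, +oo[) energy_density u.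
Proof.
(* On [[3/2, 15/8]] one has [0 < ln u <= u - 1], so the factor [(u ^+ 2 - u) / ln u] is at least
   [u], hence at least 1. *)
apply: (Rintegral_gt0 (p := 3 / 2) (q := 15 / 8) _ (@integrable_energy_density R)
  _ _ _ cos1_div_pi_gt0) => //.
- by move=> u /=; rewrite in_itv /= andbT; exact: energy_density_ge0.
- by move=> u /=; rewrite !in_itv /= => /andP[? _]; lra.
- lra.
- move=> u u12; rewrite energy_densityE.
  apply: (le_trans (norm_density_ge (u := u) _)); first by lra.
  rewrite ler_peMr ?norm_density_ge0 //.
  have l0 : 0 < ln u by rewrite ln_gt0; lra.
  have : ln u <= u - 1 by apply: ln_leB1; lra.
  by rewrite ler_pdivlMr // mul1r; nra.
Qed.

Definition norm_majorant u : R := (4 * (u + pi) ^+ 2)^-1.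

Lemma continuous_norm_majorant :
  {within `[0, pi], continuous norm_majorant}.
Proof.
apply: continuous_in_subspaceT => u /set_mem /=; rewrite in_itv /= => /andP[u0 _].
have up : 0 < u + pi by have := pi_gt0 R; lra.
apply: cvgV; first by rewrite gt_eqF // mulr_gt0 // exprn_gt0.
apply: cvgM; first exact: cvg_cst.
by apply: cvgM; apply: cvgD; (exact: cvg_id || exact: cvg_cst).
Qed.

Lemma integrable_norm_majorant :
  mu.-integrable `[0, pi] (EFin \o norm_majorant).
Proof.
apply: continuous_compact_integrable; first exact: segment_compact.
exact: continuous_norm_majorant.
Qed.

Lemma integral_norm_majorant :
  \int[mu]_(u in `[0, pi]) norm_majorant u = (8 * pi)^-1.
Proof.
have p0 := pi_gt0 R.
pose F u : R := - (4 * (u + pi))^-1.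
have dF u : 0 <= u -> is_derive u 1 F (norm_majorant u).
  move=> u0.
  have n0 : 4 * (u + pi) != 0 by rewrite gt_eqF //; nra.
  have dg : is_derive u 1 (fun u => 4 * (u + pi)) (4 : R).
    by apply: is_derive_eq; rewrite addr0 /GRing.scale /= mulr1.
  have := is_deriveN (is_deriveV (f := fun u => 4 * (u + pi)) n0 dg).
  have -> // : - (- (4 * (u + pi)) ^- 2 *: 4) = norm_majorant u.
  by rewrite /norm_majorant scaleNr opprK /GRing.scale /=; field; lra.
have dvF u : 0 <= u -> derivable F u 1 by move=> /dF h; exact: ex_derive.
have cF u : 0 <= u -> {for u, continuous F}.
  by move=> /dvF h; apply: differentiable_continuous; exact/derivable1_diffP.
rewrite /Rintegral (@continuous_FTC2 _ _ F) //.
- rewrite /F /=; move: (pi : R) p0 => c c0; field; apply/andP; split; lra.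
- exact: continuous_norm_majorant.
- split.
  + by move=> u; rewrite in_itv /= => /andP[/ltW u0 _]; exact: dvF.
  + by apply: cvg_at_right_filter; exact: cF.
  + by apply: cvg_at_left_filter; apply: cF; exact: ltW.
- move=> u; rewrite in_itv /= => /andP[/ltW u0 _].
  by have h := dF u u0; rewrite derive1E derive_val.
Qed.

Lemma integrable_norm_density : mu.-integrable `[0, pi] (EFin \o @norm_density R).
Proof.
apply: le_integrable integrable_norm_majorant => //.
  by apply/measurable_EFinP; apply: measurable_funTS; exact: measurable_norm_density.
move=> u /=; rewrite in_itv /= => /andP[u0 _].
rewrite lee_fin ger0_norm ?norm_density_ge0 // ger0_norm; first exact: norm_density_le.
by rewrite (le_trans (norm_density_ge0 u)) // norm_density_le.
Qed.

Lemma norm_integral_gt0 : 0 < \int[mu]_(u in `[0, pi]) norm_density u.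
Proof.
have p2 := pi_gt2.
apply: (Rintegral_gt0 (p := 0) (q := 1) _ integrable_norm_density
  _ _ _ cos1_div_pi_gt0) => //.
- by move=> u _; exact: norm_density_ge0.
- by move=> u /=; rewrite !in_itv /= => /andP[? ?]; lra.
- by move=> u u12; apply: norm_density_ge; lra.
Qed.

(** Strictness comes from a subinterval where [pi - u > 2]: there the trivial bound [cos ^ 2 <= 1]
    already beats the majorant by a fixed amount. *)
Lemma norm_integral_lt : \int[mu]_(u in `[0, pi]) norm_density u < (8 * pi)^-1.
Proof.
have p2 := pi_gt2.
rewrite -integral_norm_majorant -subr_gt0 -RintegralB //; last 2 first.
- exact: integrable_norm_majorant.
- exact: integrable_norm_density.
(* For [u <= (pi - 2) / 2] one has [pi - u >= (pi + 2) / 2 > 2]. The last argument bounds the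
   difference of the two functions below, using [u + pi <= pi + pi]. *)
have := @Rintegral_gt0 `[0, pi] (fun u => norm_majorant u - norm_density u)
  0 ((pi - 2) / 2) ((4^-1 - 4 / (pi + 2) ^+ 2) * (pi + pi) ^- 2).
apply => //.
- exact: integrableB integrable_norm_majorant integrable_norm_density.
- move=> u /=; rewrite in_itv /= subr_ge0 => /andP[u0 _]; exact: norm_density_le.
- by move=> u /=; rewrite !in_itv /= => /andP[-> ?]; lra.
- by lra.
- rewrite mulr_gt0 ?invr_gt0 ?exprn_gt0 ?subr_gt0 //; last by lra.
  rewrite ltr_pdivrMr; last by rewrite exprn_gt0; lra.
  by nra.
- move=> u /andP[u0 ua].
  have -> : norm_majorant u = 4^-1 * (u + pi) ^- 2 by rewrite /norm_majorant invfM.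
  apply: (@le_trans _ _ ((4^-1 - 4 / (pi + 2) ^+ 2) * (u + pi) ^- 2)).
    apply: ler_wpM2l.
      rewrite subr_ge0 ler_pdivrMr; last by rewrite exprn_gt0; lra.
      by nra.
    rewrite lef_pV2 ?posrE ?exprn_gt0 //; [|by lra|by lra].
    by rewrite ler_sqr ?nnegrE; lra.
  rewrite mulrBl lerD2l lerN2.
  have -> : 4 / (pi + 2) ^+ 2 * (u + pi) ^- 2 =
      (((pi + 2) / 2) ^+ 2 * (u + pi) ^+ 2)^-1.
    by field; apply/andP; split; lra.
  rewrite /norm_density.
  have -> : (u ^+ 2 - pi ^+ 2) ^+ 2 = (pi - u) ^+ 2 * (u + pi) ^+ 2 by ring.
  have c1 : cos (u / 2) ^+ 2 <= 1.
    by rewrite -[leRHS](expr1n _ 2) ler_sqr_norm // normr1 cos_max.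
  have d0 : 0 < (pi - u) ^+ 2 * (u + pi) ^+ 2.
    by rewrite mulr_gt0 // exprn_gt0 //; lra.
  apply: (@le_trans _ _ ((pi - u) ^+ 2 * (u + pi) ^+ 2)^-1).
    by rewrite ler_piMl // invr_ge0 ltW.
  rewrite lef_pV2 ?posrE //; last by rewrite mulr_gt0 // exprn_gt0 //; lra.
  rewrite ler_pM2r; last by rewrite exprn_gt0 //; lra.
  by rewrite ler_sqr ?nnegrE; lra.
Qed.

(** The gap between the two sides is what absorbs all error terms in the final limit. *)
Lemma energy_integral_lt_k1 :
  8 * pi * \int[mu]_(u in `[0, +oo[) energy_density u < k1 R.
Proof.
rewrite /k1 [ltLHS]mulrC ltr_pM2l; last exact: energy_integral_gt0.
rewrite -[8 * pi]invrK ltf_pV2 ?posrE.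
- exact: norm_integral_lt.
- by rewrite invr_gt0 mulr_gt0 // pi_gt0.
- exact: norm_integral_gt0.
Qed.

End constants.

(** * The Rayleigh integrand of the trial vector after rescaling *)

Section estimate.
Variable R : realType.
Local Notation mu := (@lebesgue_measure R).
Implicit Types u K : R.

(** A comparison of integrals that tolerates a countable exceptional set, meant for the points 0, 1
    and [pi]. *)
Lemma le_Rintegral_off (D S : set R) (f g : R -> R) : measurable D ->
  countable S -> mu.-integrable D (EFin \o f) -> mu.-integrable D (EFin \o g) ->
  (forall u, D u -> 0 <= f u) -> (forall u, D u -> 0 <= g u) ->
  (forall u, D u -> ~ S u -> f u <= g u) ->
  \int[mu]_(u in D) f u <= \int[mu]_(u in D) g u.
Proof.
move=> mD cS intf intg f0 g0 fg; apply: fine_le.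
- exact: integrable_fin_num intf.
- exact: integrable_fin_num intg.
apply: ae_ge0_le_integral => //.
- exact: measurable_int intf.
- exact: measurable_int intg.
exists S; split.
- exact: countable_measurable.
- exact: countable_lebesgue_measure0.
- move=> u /= /not_implyP[Du nfg]; apply: contrapT => nS; apply: nfg.
  by rewrite lee_fin fg.
Qed.

(** The cosine polynomial [p] of the overview. *)
Definition trial_poly n (t : R) : R :=
  \sum_(j < n) laplace_vector R n j * cos ((j%:R - (n%:R - 1) / 2) * t).

(* The factor E_n of the header. *)
Definition distortion n u : R :=
  (1 + u / n%:R) / cos ((u + pi) / (4 * n.+1%:R)) ^+ 8.

(** Solve the squared identity of [laplace_vector_cos] for the polynomial, bounding [sin (pi / m)]
    by [pi / m] and the cosine difference below by [sqr_cosB_ge]. The constant is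
    [(pi / m) ^+ 2 * (4 * m ^+ 4)]. *)
Lemma trial_poly_sqr_le n u : (0 < n)%N -> 0 <= u <= pi * n.+1%:R -> u != pi ->
  trial_poly n (u / n.+1%:R) ^+ 2 <=
  4 * pi ^+ 2 * n.+1%:R ^+ 2 / cos ((u + pi) / (4 * n.+1%:R)) ^+ 8 * norm_density u.
Proof.
move=> n0 um upi; set m : R := n.+1%:R; have p0 := pi_gt0 R.
have m0 : 0 < m by rewrite ltr0n.
have n1 : (1 < n.+1)%N by [].
have m2 : 2 <= m by rewrite ler_nat.
have c0 : 0 < cos ((u + pi) / (4 * m)) ^+ 8.
  rewrite exprn_gt0 // cos_gt0_pihalf //; move: um => /andP[u0 um].
  apply/andP; split.
    by rewrite (@lt_le_trans _ _ 0) ?divr_ge0 //; lra.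
  by rewrite ltr_pdivrMr; nra.
have q0 : 0 < (u ^+ 2 - pi ^+ 2) ^+ 2.
  rewrite exprn_even_gt0 //= subr_eq0 eqf_sqr negb_or upi /=.
  by rewrite gt_eqF //; move: um => /andP[]; lra.
have := sqr_cosB_ge n1 um; rewrite -/m.
set Q := (cos (u / m) - cos (pi / m)) ^+ 2 => Qge.
have PQ : trial_poly n (u / m) ^+ 2 * Q = sin (pi / m) ^+ 2 * cos (u / 2) ^+ 2.
  rewrite -exprMn /trial_poly laplace_vector_cos -/m exprMn.
  by rewrite [m * _]mulrC divfK // gt_eqF.
have sa : sin (pi / m) ^+ 2 <= (pi / m) ^+ 2 by exact/ler_sqr_norm/norm_sin_le.
have h : trial_poly n (u / m) ^+ 2 *
    ((u ^+ 2 - pi ^+ 2) ^+ 2 / (4 * m ^+ 4) * cos ((u + pi) / (4 * m)) ^+ 8) <=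
    (pi / m) ^+ 2 * cos (u / 2) ^+ 2.
  apply: (@le_trans _ _ (trial_poly n (u / m) ^+ 2 * Q)).
    by rewrite ler_wpM2l ?sqr_ge0.
  by rewrite PQ ler_wpM2r ?sqr_ge0.
have d0 : 0 < (u ^+ 2 - pi ^+ 2) ^+ 2 / (4 * m ^+ 4) * cos ((u + pi) / (4 * m)) ^+ 8.
  by rewrite mulr_gt0 // divr_gt0 // mulr_gt0 // exprn_gt0.
move: h; rewrite -ler_pdivlMr // => /le_trans; apply.
move: c0 q0; rewrite /norm_density.
set c := cos (_ / (4 * m)) ^+ 8; set q := (_ - _) ^+ 2 => c0 q0.
rewrite le_eqVlt; apply/orP; left; apply/eqP.
move: (pi : R) => p; field.
by rewrite !gt_eqF.
Qed.

Lemma continuous_trial_poly n : continuous (trial_poly n).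
Proof.
apply: continuous_sumr => j t.
by apply: cvgM; [exact: cvg_cst|exact: continuous_cosM].
Qed.

Lemma symbol_ge0 n (t : R) : 0 <= symbol n t.
Proof. by apply: sumr_ge0 => j _; rewrite mulr_ge0 ?powR_ge0. Qed.

Lemma symbolN n (t : R) : symbol n (- t) = symbol n t.
Proof. by rewrite /symbol; under eq_bigr do rewrite normrN. Qed.

Lemma trial_polyN n (t : R) : trial_poly n (- t) = trial_poly n t.
Proof. by rewrite /trial_poly; under eq_bigr do rewrite mulrN cosN. Qed.

Definition trial_energy n (t : R) : R := symbol n t * trial_poly n t ^+ 2.

Lemma continuous_trial_energy n : (0 < n)%N -> continuous (trial_energy n).
Proof.
move=> n0 t; apply: cvgM; first exact: continuous_symbol.
by apply: cvgM; exact: continuous_trial_poly.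
Qed.

Lemma trial_energy_le n u : (0 < n)%N -> 0 <= u <= pi * n.+1%:R ->
  u != 0 -> u != 1 -> u != pi ->
  trial_energy n (u / n.+1%:R) <=
  4 * pi ^+ 2 * n.+1%:R ^+ 2 / n%:R * distortion n u * energy_density u.
Proof.
move=> n0 um u0 u1 upi.
have u_gt0 : 0 < u by rewrite lt_neqAle eq_sym u0; case/andP: um.
rewrite energy_densityE /distortion.
have hs := @symbol_div_le R n n.+1 u; rewrite n0 leqnSn in hs.
apply: (le_trans (ler_pM _ _ (hs isT u_gt0 u1) (trial_poly_sqr_le n0 um upi))).
- exact: symbol_ge0.
- exact: sqr_ge0.
by rewrite le_eqVlt; apply/orP; left; apply/eqP; ring.
Qed.

(** The vector has squared norm [n.+1 / 2], evenness of the integrand doubles the integral over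
    [[0, pi]], and the substitution [t = u / n.+1] contributes a further [1 / n.+1]. *)
Lemma smallest_eigenvalue_le_trial n (l : R) : (0 < n)%N ->
  smallest_eigenvalue (toeplitz n (@symbol R n)) l ->
  n%:R * l <= 2 * n%:R / (pi * n.+1%:R ^+ 2) *
    \int[mu]_(u in `[0, pi * n.+1%:R]) trial_energy n (u / n.+1%:R).
Proof.
move=> n0 hl; have p0 := pi_gt0 R.
have := toeplitz_rayleigh (laplace_vector R n) (@continuous_symbol R n n0) hl.
rewrite laplace_vector_norm //.
under eq_Rintegral do rewrite laplace_vector_form -/(trial_poly n _) -/(trial_energy n _).
rewrite Rintegral_even ?pi_ge0 //; last 2 first.
- exact: continuous_trial_energy.
- by move=> t; rewrite /trial_energy symbolN trial_polyN.
rewrite (Rintegral_scale (m := n.+1%:R)) ?pi_ge0 //; last exact: continuous_trial_energy.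
set I := Rintegral _ _ _; set m : R := n.+1%:R.
have m0 : 0 < m by rewrite ltr0n.
rewrite -ler_pdivlMr ?divr_gt0 // => h.
apply: le_trans (ler_wpM2l (ler0n _ n) h) _.
rewrite le_eqVlt; apply/orP; left; apply/eqP.
move: (pi : R) p0 I {h} => p p0 I; field.
by rewrite !gt_eqF.
Qed.

(** At the extreme case [n = 1], [u = 2 * pi], the ratio [u / n] is [2 * pi] and the angle is
    [3 * pi / 8], still below [pi / 2]. *)
Lemma distortion_bounds n u : (0 < n)%N -> 0 <= u <= pi * n.+1%:R ->
  0 <= distortion n u <= (1 + 2 * pi) / cos (3 * pi / 8) ^+ 8.
Proof.
move=> n0 /andP[u0 um]; have p0 := pi_gt0 R; rewrite /distortion.
have n1 : 1 <= n%:R :> R by rewrite ler1n.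
have n0' : 0 < n%:R :> R by rewrite ltr0n.
move: um; rewrite -natr1 => um.
have m0 : 0 < 4 * (n%:R + 1) :> R by lra.
have a0 : 0 <= (u + pi) / (4 * (n%:R + 1)) by rewrite divr_ge0 //; lra.
have a1 : (u + pi) / (4 * (n%:R + 1)) <= 3 * pi / 8.
  by rewrite ler_pdivrMr //; nra.
have k0 : 0 < cos (3 * pi / 8 : R) by apply: cos_gt0_pihalf; lra.
have cK : cos (3 * pi / 8) <= cos ((u + pi) / (4 * (n%:R + 1))).
  move: a1; rewrite le_eqVlt => /predU1P[->//|a1].
  by rewrite ltW // ltr_cos // in_itv /=; lra.
have un : u / n%:R <= 2 * pi by rewrite ler_pdivrMr //; nra.
have un0 : 0 <= u / n%:R by rewrite divr_ge0 // ltW.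
have c0 := lt_le_trans k0 cK.
rewrite divr_ge0 ?exprn_ge0 ?(ltW c0) //=; last by lra.
apply: ler_pM => //; first by lra.
- by rewrite invr_ge0 exprn_ge0 // ltW.
- by lra.
- rewrite lef_pV2 ?posrE ?exprn_gt0 //.
  by rewrite ler_pXn2r ?nnegrE // ltW.
Qed.

(** The numerator grows with [u], while the cosine decreases and stays positive as its angle does
    not exceed [3 * pi / 8]. *)
Lemma distortion_mono n u K : (0 < n)%N -> 0 <= u <= K -> K <= pi * n.+1%:R ->
  distortion n u <= distortion n K.
Proof.
move=> n0 /andP[u0 uK] Km; have p0 := pi_gt0 R; rewrite /distortion.
have n1 : 1 <= n%:R :> R by rewrite ler1n.
have n0' : 0 < n%:R :> R by rewrite ltr0n.
move: Km; rewrite -natr1 => Km.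
have m0 : 0 < 4 * (n%:R + 1) :> R by lra.
have a0 : 0 <= (u + pi) / (4 * (n%:R + 1)) by rewrite divr_ge0 //; lra.
have aK : (u + pi) / (4 * (n%:R + 1)) <= (K + pi) / (4 * (n%:R + 1)).
  by rewrite ler_pM2r ?invr_gt0 //; lra.
have K1 : (K + pi) / (4 * (n%:R + 1)) <= 3 * pi / 8.
  by rewrite ler_pdivrMr //; nra.
have k0 : 0 < cos ((K + pi) / (4 * (n%:R + 1))) by apply: cos_gt0_pihalf; lra.
have cK : cos ((K + pi) / (4 * (n%:R + 1))) <= cos ((u + pi) / (4 * (n%:R + 1))).
  move: aK; rewrite le_eqVlt => /predU1P[->//|aK].
  by rewrite ltW // ltr_cos // in_itv /=; lra.
have c0 := lt_le_trans k0 cK.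
apply: ler_pM.
- by rewrite addr_ge0 // divr_ge0 // ltW.
- by rewrite invr_ge0 exprn_ge0 // ltW.
- by rewrite lerD2l ler_pM2r ?invr_gt0.
- rewrite lef_pV2 ?posrE ?exprn_gt0 //.
  by rewrite ler_pXn2r ?nnegrE // ltW.
Qed.

End estimate.

(** * The Rayleigh quotient bound *)

Section eigenvalue_bound.
Variable R : realType.
Local Notation mu := (@lebesgue_measure R).
Local Notation N := (\int[mu]_(u in `[0, +oo[) energy_density u).
Implicit Types u K : R.

Lemma continuous_scaled_energy n : (0 < n)%N ->
  continuous (fun u : R => trial_energy n (u / n.+1%:R)).
Proof.
move=> n0 u.
have cF : {for u, continuous (fun u : R => u / n.+1%:R)}.
  by apply: cvgM; [exact: cvg_id|exact: cvg_cst].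
by apply: (continuous_comp cF); exact: continuous_trial_energy.
Qed.

Lemma trial_energy_piece n (A : set R) (M : R) : (0 < n)%N -> measurable A ->
  A `<=` `[0, pi * n.+1%:R] -> 0 <= M ->
  (forall u, A u -> distortion n u <= M) ->
  \int[mu]_(u in A) trial_energy n (u / n.+1%:R) <=
  4 * pi ^+ 2 * n.+1%:R ^+ 2 / n%:R * (M * \int[mu]_(u in A) energy_density u).
Proof.
move=> n0 mA A0 M0 AM.
have c0 : 0 <= 4 * pi ^+ 2 * n.+1%:R ^+ 2 / n%:R :> R.
  by rewrite divr_ge0 // mulr_ge0 ?sqr_ge0 // mulr_ge0 ?sqr_ge0.
have Aint u : A u -> 0 <= u <= pi * n.+1%:R by move=> /A0 /=; rewrite in_itv.
have intW : mu.-integrable A (EFin \o @energy_density R).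
  apply: (integrableS (mu := mu) _ mA _ (@integrable_energy_density R)) => // u.
  by move=> /Aint /andP[u0 _]; rewrite /= in_itv /= u0.
have intMW := integrableZl (mu := mu) mA (4 * pi ^+ 2 * n.+1%:R ^+ 2 / n%:R * M) intW.
rewrite mulrA -(RintegralZl (mu := mu) _ mA intW).
have intE : mu.-integrable A (EFin \o (fun u => trial_energy n (u / n.+1%:R))).
  have h := continuous_integrable_itv 0 (pi * n.+1%:R) (continuous_scaled_energy n0).
  exact: (integrableS (mu := mu) (measurable_itv _) mA A0 h).
apply: (@le_Rintegral_off _ A [set 0; 1; pi]) => //.
- by apply: finite_set_countable; rewrite !finite_setU; do ![split].
- by move=> u _; rewrite mulr_ge0 ?symbol_ge0 ?sqr_ge0.
- move=> u /Aint /andP[u0 _].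
  by rewrite mulr_ge0 ?energy_density_ge0 // mulr_ge0.
- move=> u Au /= /not_orP[/not_orP[/eqP h0 /eqP h1] /eqP hpi].
  apply: le_trans (trial_energy_le n0 (Aint _ Au) h0 h1 hpi) _.
  have /andP[u0 _] := Aint _ Au.
  by rewrite ler_wpM2r ?energy_density_ge0 // ler_wpM2l // AM.
Qed.

(** The integral is split at [K]. On the head, the distortion is at most its value at [K]; on the
    rest, it is at most the uniform constant [C], and [energy_density_tail] makes the contribution
    small. The prefactors multiply to [8 * pi]. *)
Lemma smallest_eigenvalue_le n (l K : R) : (0 < n)%N ->
  smallest_eigenvalue (toeplitz n (@symbol R n)) l -> 0 <= K <= pi * n.+1%:R ->
  n%:R * l <= 8 * pi * (distortion n K * N +
    (1 + 2 * pi) / cos (3 * pi / 8) ^+ 8 * (17 * (pi / 2 - atan K))).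
Proof.
move=> n0 hl /andP[K0 Km]; have p0 := pi_gt0 R.
set C := (1 + 2 * pi) / _.
have coef0 : 0 <= 4 * pi ^+ 2 * n.+1%:R ^+ 2 / n%:R :> R.
  by rewrite divr_ge0 // mulr_ge0 ?sqr_ge0 // mulr_ge0 ?sqr_ge0.
have mpos : 0 < n.+1%:R :> R by rewrite ltr0n.
have npos : 0 < n%:R :> R by rewrite ltr0n.
have dC u : 0 <= u <= pi * n.+1%:R -> 0 <= distortion n u <= C.
  exact: distortion_bounds.
have dK0 : 0 <= distortion n K <= C by rewrite dC // K0.
have C0 : 0 <= C by case/andP: dK0; exact: le_trans.
apply: le_trans (smallest_eigenvalue_le_trial n0 hl) _.
have := @Rintegral_itvB R (fun u => trial_energy n (u / n.+1%:R)) (BLeft 0)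
  (BRight (pi * n.+1%:R)) K (continuous_integrable_itv _ _ (continuous_scaled_energy n0)).
rewrite !bnd_simp K0 Km => /(_ isT isT)/eqP; rewrite subr_eq => /eqP ->.
have h1 : \int[mu]_(u in `[0, K]) trial_energy n (u / n.+1%:R) <=
   4 * pi ^+ 2 * n.+1%:R ^+ 2 / n%:R * (distortion n K * N).
  apply: le_trans (trial_energy_piece n0 _ _ (M := distortion n K) _ _) _ => //.
  - by move=> u /=; rewrite !in_itv /= => /andP[-> /le_trans]; apply.
  - by case/andP: dK0.
  - by move=> u /=; rewrite in_itv /= => uK; exact: distortion_mono.
  - rewrite ler_wpM2l ?coef0 // ler_wpM2l //; first by case/andP: dK0.
    apply: le_Rintegral_subset => //; first exact: integrable_energy_density.
    + by move=> u /=; rewrite in_itv /= andbT; exact: energy_density_ge0.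
    + by move=> u /=; rewrite !in_itv /= => /andP[->].
have h2 : \int[mu]_(u in `]K, pi * n.+1%:R]) trial_energy n (u / n.+1%:R) <=
   4 * pi ^+ 2 * n.+1%:R ^+ 2 / n%:R * (C * (17 * (pi / 2 - atan K))).
  have KK u : K < u -> 0 <= u by move=> /ltW; exact: le_trans.
  apply: le_trans (trial_energy_piece n0 _ _ C0 _) _ => //.
  - by move=> u /=; rewrite !in_itv /= => /andP[/KK -> ->].
  - move=> u /=; rewrite in_itv /= => /andP[/KK u0 um].
    by have := dC u; rewrite u0 um => /(_ isT)/andP[].
  - rewrite ler_wpM2l ?coef0 // ler_wpM2l //.
    apply: le_trans (energy_density_tail K0).
    apply: le_Rintegral_subset => //.
    + apply: (integrableS (mu := mu) _ _ _ (@integrable_energy_density R)) => // u.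
      by rewrite /= !in_itv /= !andbT => /KK.
    + by move=> u /=; rewrite in_itv /= andbT => /KK; exact: energy_density_ge0.
    + by move=> u /=; rewrite !in_itv /= => /andP[-> _].
apply: le_trans (ler_wpM2l _ (lerD h2 h1)) _.
  by rewrite divr_ge0 // mulr_ge0 ?sqr_ge0 // ltW.
rewrite le_eqVlt; apply/orP; left; apply/eqP.
move: (distortion n K * N) (C * _) => a b; rewrite -mulrDr.
move: (pi : R) p0 (n.+1%:R : R) mpos => p p0 m m0; field.
by rewrite !gt_eqF.
Qed.

End eigenvalue_bound.

(** * Passage to the limit *)

Lemma cvg_distortion (R : realType) (K : R) :
  distortion n K @[n --> \oo] --> (1 : R).
Proof.
have inv0 : (n%:R : R)^-1 @[n --> \oo] --> (0 : R).
  apply/gtr0_cvgV0; last exact: cvgr_idn.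
  by near=> n; rewrite ltr0n; near: n; exact: nbhs_infty_gt.
have invS0 : (n.+1%:R : R)^-1 @[n --> \oo] --> (0 : R) by exact: cvg_harmonic.
have arg0 : (K + pi) / 4 * (n.+1%:R : R)^-1 @[n --> \oo] --> (0 : R).
  rewrite -[X in _ --> X](mulr0 ((K + pi) / 4)).
  by apply: cvgM; [exact: cvg_cst|exact: invS0].
have cos1 : cos ((K + pi) / 4 * (n.+1%:R : R)^-1) @[n --> \oo] --> (1 : R).
  by rewrite -[X in _ --> X](cos0 R); apply: continuous_cvg arg0; exact: continuous_cos.
rewrite [X in _ --> X](_ : 1 = (1 + K * 0) * (1 ^+ 8)^-1 :> R); last first.
  by rewrite mulr0 addr0 expr1n invr1 mulr1.
rewrite /distortion; apply: cvgM.
  by apply: cvgD; [exact: cvg_cst|apply: cvgM; [exact: cvg_cst|exact: inv0]].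
apply: cvgV; first by rewrite expr1n oner_neq0.
under eq_cvg do rewrite invfM mulrA.
have c8 : {for 1, continuous (fun x : R => x ^+ 8)} by exact: exprn_continuous.
exact: (cvg_comp _ _ cos1 c8).
Unshelve. all: by end_near. Qed.

Theorem theorem2p1 (R : realType) :
  exists lambda1 : nat -> R,
    (forall n : nat, (0 < n)%N ->
       smallest_eigenvalue (toeplitz n (@symbol R n)) (lambda1 n)) /\
    (exists2 g : nat -> R,
       g =O_\oo (fun n : nat => n%:R^-1 : R) &
       \forall n \near \oo, n%:R * lambda1 n <= k1 R + g n).
Proof.
(* The default 0 is only taken when there is no smallest eigenvalue, which cannot happen for
   [n > 0]. *)
pose lambda1 n : R :=
    xget 0 [set l | smallest_eigenvalue (toeplitz n (@symbol R n)) l].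
have lambda1P n : (0 < n)%N ->
    smallest_eigenvalue (toeplitz n (@symbol R n)) (lambda1 n).
  move=> n0; have hA := toeplitz_hermitian n (@continuous_symbol R n n0).
  have [l hl] := hermitian_smallest_eigenvalue n0 hA.
  by rewrite /lambda1; case: xgetP => [l' _ //|/(_ l)].
(* The gap [d] below [k1] is strict, so eventually [n * lambda1 n <= k1] and the zero function
   serves as the error term. *)
exists lambda1; split=> //; exists (cst 0).
  apply/eqOP; near=> k; apply: nearW => n.
  by rewrite normr0 mulr_ge0 //; near: k; exact: nbhs_pinfty_ge.
set N := \int[lebesgue_measure]_(u in `[0, +oo[) (@energy_density R u).
set C : R := (1 + 2 * pi) / cos (3 * pi / 8) ^+ 8.
have p0 := pi_gt0 R; have N0 := energy_integral_gt0 R.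
have := energy_integral_lt_k1 R; rewrite -/N in N0 *.
rewrite -subr_gt0; set d := k1 R - _ => d0.
(* First fix [K] so that the tail uses at most half of the gap, uniformly in [n]. *)
have [K [K0 KC]] : exists K : R, 0 <= K /\
    8 * pi * (C * (17 * (pi / 2 - atan K))) <= d / 2.
  have tail0 : 8 * pi * (C * (17 * (pi / 2 - atan K))) @[K --> +oo] --> (0 : R).
    rewrite [X in _ --> X](_ : 0 = 8 * pi * (C * (17 * (pi / 2 - pi / 2)))).
      do 3 (apply: cvgM; first exact: cvg_cst).
      by apply: cvgB; [exact: cvg_cst|exact: cvgy_atan].
    by rewrite subrr !mulr0.
  have : \forall K \near +oo, 0 <= K /\
      8 * pi * (C * (17 * (pi / 2 - atan K))) <= d / 2.
    near=> K; split; first by near: K; exact: nbhs_pinfty_ge.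
    near: K; apply: (cvgr_le _ tail0); exact: divr_gt0.
  by move=> /filter_ex.
have : 8 * pi * (distortion n K * N) @[n --> \oo] --> 8 * pi * (1 * N).
  apply: cvgM; first exact: cvg_cst.
  by apply: cvgM; [exact: cvg_distortion|exact: cvg_cst].
move=> cvgN.
near=> n.
have n0 : (0 < n)%N by near: n; exact: nbhs_infty_gt.
have Kn : K <= pi * n.+1%:R.
  have : K <= n%:R by near: n; exact: nbhs_infty_ger.
  by have := pi_ge2 R; rewrite -natr1; have : 0 <= n%:R :> R by []; nra.
rewrite addr0 (le_trans (smallest_eigenvalue_le n0 (lambda1P n n0) (_ : 0 <= K <= _))) //.
  by rewrite K0.
rewrite -/N -/C mulrDr.
(* With [K] fixed, the distortion tends to 1, and for large [n] its excess uses at most the other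
   half. *)
have : 8 * pi * (distortion n K * N) <= 8 * pi * (1 * N) + d / 2.
  near: n; apply: (cvgr_le _ cvgN).
  by rewrite ltrDl divr_gt0.
rewrite mul1r; move: KC; rewrite /d; lra.
Unshelve. all: by end_near.
Qed.
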